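(* Let $R$ be a ring with identity and $a\in R$. Then the following are equivalent: (1) $a$ is naturally invertible, with natural inverse $a^{\parallel M}$; (2) there exists $b\in\{a\}''$ such that $bab=b$ and $\Sigma_2(a-aba)=\{0\}$; (3) there exist $x,y\in R$ with $a=x+y$, $x\in\{a\}''$, $x$ group invertible (i.e. $x^\#$ exists), $xy=0$ and $\Sigma_2(y)=\{0\}$. In this case, $a^{\parallel M}=b=x^\#$ (for $b$ as in (2) and $x$ as in (3)).
   Context: Rings are associative with identity. For $A\subseteq R$, $A'=\{x\in R: xa=ax\ \forall a\in A\}$ and $A''=(A')'$. $E(R)$ is the set of idempotents of $R$, with natural partial order $e\le f\iff ef=fe=e$. Green's relations are those of the multiplicative monoid $R$: $x\leq_{\mathcal L}y\iff x\in Ry$; $x\leq_{\mathcal R}y\iff x\in yR$; $x\leq_{\mathcal H}y$ iff both hold; $x\,\mathcal H\,y$ iff $x\leq_{\mathcal H}y$ and $y\leq_{\mathcal H}x$. Inverse along an element: $a$ is invertible along $d$ if there is $b$ with $bad=d=dab$ and $b\leq_{\mathcal H}d$; such $b$ is unique and denoted $a^{\parallel d}$. For an idempotent $e$, $a^{\parallel e}$ exists if and only if $eae\,\mathcal H\,e$. For $c\in R$, $\Sigma_2(c)=\{e\in E(R): ece\,\mathcal H\,e\}\cap\{c\}''$. The element $a$ is naturally invertible if $\Sigma_2(a)$ has a greatest element $M$ for the natural partial order; then $a^{\parallel M}$ is called the natural inverse of $a$. The group inverse $x^\#$ of $x$ is the (unique if it exists) element $z$ with $xzx=x$, $zxz=z$,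 $xz=zx$. *)

(* Defs.v *)
From mathcomp Require Import all_boot all_algebra.
From mathcomp Require Import classical_sets.

Set Implicit Arguments.
Unset Strict Implicit.
Unset Printing Implicit Defensive.

Import GRing.Theory.

Local Open Scope classical_set_scope.
Local Open Scope ring_scope.

(* Rings are arbitrary associative rings with identity; [pzRingType] does not
   require [1 != 0]. *)

Definition commutant (R : pzRingType) (A : set R) : set R :=
  [set x | forall a, A a -> x * a = a * x].

Definition bicommutant (R : pzRingType) (A : set R) : set R :=
  commutant (commutant A).

Definition idempotents (R : pzRingType) : set R := [set e | e * e = e].

Definition idem_le (R : pzRingType) (e f : R) : Prop :=
  e * f = e /\ f * e = e.

Definition green_leL (R : pzRingType) (x y : R) : Prop := exists r, x = r * y.

Definition green_leR (R : pzRingType) (x y : R) : Prop := exists r, x = y * r.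

Definition green_leH (R : pzRingType) (x y : R) : Prop :=
  green_leL x y /\ green_leR x y.

Definition green_H (R : pzRingType) (x y : R) : Prop :=
  green_leH x y /\ green_leH y x.

(* [inverse_along a d b] reads b = a^{||d}, and [group_inverse x z] reads
   z = x^#; both are graphs of partial functions. *)
Definition inverse_along (R : pzRingType) (a d b : R) : Prop :=
  [/\ b * a * d = d, d * a * b = d & green_leH b d].

Definition group_inverse (R : pzRingType) (x z : R) : Prop :=
  [/\ x * z * x = x, z * x * z = z & x * z = z * x].

Definition Sigma2 (R : pzRingType) (c : R) : set R :=
  [set e | idempotents e /\ green_H (e * c * e) e] `&` bicommutant [set c].

Definition greatest_idem (R : pzRingType) (S : set R) (M : R) : Prop :=
  S M /\ (forall e, S e -> idem_le e M).

Definition naturally_invertible (R : pzRingType) (a : R) : Prop :=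
  exists M, greatest_idem (Sigma2 a) M.

(* Main.v *)
(** Elements of the bicommutant of [a] commute with each other.  If [b] lies in
    it and [bab = b], then [p = ab] is an idempotent of [Sigma2 a], and
    [Sigma2 (a - aba)] consists of the [e] in [Sigma2 a] with [ep = 0].  For
    every [e] in [Sigma2 a], [e(1 - p)] is such an element; hence
    [Sigma2 (a - aba)] is trivial exactly when [p] is the greatest element of
    [Sigma2 a], which makes [b] the inverse of [a] along [p].  Finally, in (3)
    one has [a x^# = x x^#] and [x = a x^# a], which is the setting of (2). *)
Require Import Defs.
From mathcomp Require Import all_boot all_algebra.
From mathcomp Require Import classical_sets.

Set Implicit Arguments.
Unset Strict Implicit.
Unset Printing Implicit Defensive.

Import GRing.Theory.

Local Open Scope classical_set_scope.
Local Open Scope ring_scope.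

(** * The bicommutant and the inverses it contains *)

Section Bicommutant.
Variable R : pzRingType.
Implicit Types a b c e x y z : R.

Lemma commutant1P a x : commutant [set a] x <-> x * a = a * x.
Proof. by split=> [/(_ a erefl)|xa _ ->]. Qed.

Lemma bicommutant1P a x :
  bicommutant [set a] x <-> (forall z, z * a = a * z -> x * z = z * x).
Proof. by split=> h z /commutant1P/h. Qed.

Lemma bicommutant_self a : bicommutant [set a] a.
Proof. by apply/bicommutant1P=> z ->. Qed.

Lemma bicommutant_trans a b x :
  bicommutant [set a] b -> bicommutant [set b] x -> bicommutant [set a] x.
Proof.
move=> /bicommutant1P hb /bicommutant1P hx.
by apply/bicommutant1P=> z /hb bz; apply: hx.
Qed.

Lemma bicommutant_comm a x y :
  bicommutant [set a] x -> bicommutant [set a] y -> x * y = y * x.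
Proof.
move=> /bicommutant1P hx /bicommutant1P hy; apply: hx.
exact: hy.
Qed.

Lemma bicommutantM a x y :
  bicommutant [set a] x -> bicommutant [set a] y -> bicommutant [set a] (x * y).
Proof.
move=> /bicommutant1P hx /bicommutant1P hy; apply/bicommutant1P=> z za.
by rewrite -mulrA hy // mulrA hx // mulrA.
Qed.

Lemma bicommutantB a x y :
  bicommutant [set a] x -> bicommutant [set a] y -> bicommutant [set a] (x - y).
Proof.
move=> /bicommutant1P hx /bicommutant1P hy; apply/bicommutant1P=> z za.
by rewrite mulrBl mulrBr hx // hy.
Qed.

Lemma bicommutant0 a : bicommutant [set a] 0.
Proof. by apply/bicommutant1P=> z _; rewrite mulr0 mul0r. Qed.

(** Here [u] is the inverse of [a * e] in the corner ring [eRe]; what commutes with [a] commutes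
    with [e], hence with this inverse. *)
Lemma corner_inverse_bicommutant a e u :
  bicommutant [set a] e -> e * u = u -> u * e = u -> a * u = e -> u * a = e ->
  bicommutant [set a] u.
Proof.
move=> /bicommutant1P he eu ue au ua; apply/bicommutant1P=> z za.
(* [uz = uez = uzau = uazu = ezu = zeu = zu] *)
rewrite -{1}ue -mulrA he // -{1}au [z * _]mulrA za -[a * z * u]mulrA mulrA ua.
by rewrite mulrA he // -mulrA eu.
Qed.

Lemma group_inverse_bicommutant x z :
  group_inverse x z -> bicommutant [set x] z.
Proof.
move=> [xzx zxz xz].
have zxE : z * (x * z) = z by rewrite mulrA.
apply: (@corner_inverse_bicommutant _ (x * z)) => //.
(* For the idempotent [e = x * z], both [et] and [te] equal [ete]. *)
apply/bicommutant1P=> t tx; transitivity (x * z * t * (x * z)).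
- transitivity (z * (t * (x * z * x))); first by rewrite xzx tx xz mulrA.
  by rewrite [in RHS]xz -!mulrA [x * (t * _)]mulrA -tx !mulrA.
- transitivity (x * z * x * t * z); last by rewrite xzx -tx mulrA.
  by rewrite -!mulrA [t * _]mulrA tx !mulrA.
- by rewrite xz.
Qed.

End Bicommutant.

Arguments bicommutant_self {R} a.
Arguments bicommutant1P {R a x}.

(** * [Sigma2] in terms of corner inverses *)

Section Sigma2.
Variable R : pzRingType.
Implicit Types a b c e u x y z : R.

(** As [e] commutes with [a], the relation [eae H e] only asks for an inverse of [ea] modulo [e];
    [u] itself may lie outside the corner [eRe]. *)
Lemma Sigma2_intro a e u :
  e * e = e -> bicommutant [set a] e -> a * u = e -> u * a = e -> Sigma2 a e.
Proof.
move=> ee he au ua.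
have ea : e * a = a * e by apply: bicommutant_comm he (bicommutant_self a).
split=> //; split=> //; split; split.
- by exists (e * a).
- by exists (a * e); rewrite mulrA.
- by exists u; rewrite ea -mulrA ee mulrA ua ee.
- by exists u; rewrite ea -[a * e * e]mulrA ee -ea -mulrA au ee.
Qed.

Lemma Sigma2_elim a e :
  Sigma2 a e ->
  [/\ e * e = e, bicommutant [set a] e
    & exists u, [/\ bicommutant [set a] u, e * u = u, u * e = u,
                    a * u = e & u * a = e]].
Proof.
move=> [[ee [_ [[r er] [s es]]]] he]; split=> //.
have ea : e * a = a * e by apply: bicommutant_comm he (bicommutant_self a).
have eae : e * a * e = e * a by rewrite -mulrA -ea mulrA ee.
rewrite eae in er es.
(* Left and right inverses of [ea] in the corner coincide: [re = r(eas) = (rea)s = es]. *)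
have re : r * e = e * s by rewrite [in LHS]es mulrA -er.
have eu : e * (e * s) = e * s by rewrite mulrA ee.
have ue : e * s * e = e * s by rewrite -re -mulrA ee.
have au : a * (e * s) = e by rewrite mulrA -ea.
have ua : e * s * a = e by rewrite -re -mulrA.
exists (e * s); split=> //.
exact: corner_inverse_bicommutant he eu ue au ua.
Qed.

(** Writing [b = ds] and [b' = rd], both equal [b'ab]: [ds = b'ads] and [rd = rdab]. *)
Lemma inverse_along_uniq a d b b' :
  inverse_along a d b -> inverse_along a d b' -> b = b'.
Proof.
move=> [bad dab [_ [s bE]]] [b'ad dab' [[r b'E] _]].
by rewrite bE -b'ad -mulrA -bE b'E -!mulrA [d * (a * b)]mulrA dab.
Qed.

Lemma inverse_along_mul a b :
  a * b = b * a -> b * a * b = b -> inverse_along a (a * b) b.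
Proof.
move=> ab bab; split; last split.
- by rewrite -ab -!mulrA [b * (a * b)]mulrA bab.
- by rewrite -!mulrA [b * (a * b)]mulrA bab.
- by exists b; rewrite mulrA.
- by exists b; rewrite ab.
Qed.

(** * Splitting off the idempotent [p = ab] of an outer inverse [b] *)

Section Reduction.
Variables a b : R.
Hypotheses (hb : bicommutant [set a] b) (bab : b * a * b = b).

Let ab : a * b = b * a.
Proof. exact: bicommutant_comm (bicommutant_self a) hb. Qed.

Let hab : bicommutant [set a] (a * b).
Proof. exact: bicommutantM (bicommutant_self a) hb. Qed.

Let abab : a * b * (a * b) = a * b.
Proof. by rewrite -mulrA [b * _]mulrA bab. Qed.

Lemma Sigma2_mul : Sigma2 a (a * b).
Proof. exact: (@Sigma2_intro _ _ b). Qed.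

Lemma bicommutant_sub : bicommutant [set a] (a - a * b * a).
Proof.
have ha := bicommutant_self a.
by apply: bicommutantB => //; apply: bicommutantM.
Qed.

Let subl : a * b * (a - a * b * a) = 0.
Proof. by rewrite mulrBr [_ * (_ * a)]mulrA abab subrr. Qed.

Let subr : (a - a * b * a) * (a * b) = 0.
Proof. by rewrite -(bicommutant_comm hab bicommutant_sub). Qed.

(** Put [c = a - aba]. If [ep = 0] then [ea = ec], so a corner inverse of one of [a], [c] serves the
    other. The delicate point is that [e] in [{a}''] also lies in [{c}''], which is a priori
    smaller. *)
Lemma Sigma2_sub e :
  Sigma2 (a - a * b * a) e <-> Sigma2 a e /\ e * (a * b) = 0.
Proof.
have ha := bicommutant_self a.
set c := a - a * b * a; have pc : a * b * c = 0 := subl.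
have cp : c * (a * b) = 0 := subr; split.
- move=> /Sigma2_elim[ee hce [u [_ eu ue cu uc]]].
  have he : bicommutant [set a] e := bicommutant_trans bicommutant_sub hce.
  have ep : e * (a * b) = 0 by rewrite -uc -mulrA cp mulr0.
  have ec : e * c = e * a by rewrite mulrBr [e * (_ * a)]mulrA ep mul0r subr0.
  split=> //; apply: (@Sigma2_intro _ _ u) => //.
  + by rewrite -eu mulrA -(bicommutant_comm he ha) -ec -mulrA cu.
  + by rewrite -ue -mulrA -ec mulrA ue.
- move=> [/Sigma2_elim[ee he [u [_ eu ue au ua]]] ep].
  have pe : a * b * e = 0 by rewrite (bicommutant_comm hab he).
  have cu : c * u = e by rewrite mulrBl -[a * b * a * u]mulrA au pe subr0.
  have uc : u * c = e.
    by rewrite mulrBr -[a * b * a]mulrA [u * (a * _)]mulrA ua -ab ep subr0.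
  apply: (@Sigma2_intro _ _ u) => //; apply/bicommutant1P => z zc.
  pose q := 1 - a * b.
  have aq : a * q = c by rewrite mulrBr mulr1 ab mulrA.
  have qa : q * a = c by rewrite mulrBl mul1r.
  have qc : q * c = c by rewrite mulrBl mul1r pc subr0.
  have cq : c * q = c by rewrite mulrBr mulr1 cp subr0.
  have eq : e * q = e by rewrite mulrBr mulr1 ep subr0.
  have qe : q * e = e by rewrite mulrBl mul1r pe subr0.
  (* [z] need not commute with [a], but its corner [qzq] does. *)
  have wa : q * z * q * a = a * (q * z * q).
    by rewrite -[_ * q * a]mulrA qa -mulrA zc !mulrA aq qc -zc -mulrA cq zc.
  have ew := bicommutant1P.1 he _ wa.
  (* Since [e = uc = cu] and [z] commutes with [c], the mixed terms [ezp] and [pze] vanish, so [e]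
     sees only the corner [qzq] of [z]. *)
  have ezp : e * z * (a * b) = 0.
    by rewrite -uc -[u * c * z]mulrA -zc -!mulrA cp !mulr0.
  have pze : a * b * z * e = 0.
    by rewrite -cu mulrA -[a * b * z * c]mulrA zc mulrA pc !mul0r.
  have ez : e * z = e * (q * z * q).
    by rewrite !mulrA eq mulrBr mulr1 ezp subr0.
  have ze : z * e = q * z * q * e.
    by rewrite -mulrA qe mulrBl mul1r mulrBl pze subr0.
  by rewrite ez ew ze.
Qed.

Lemma greatest_Sigma2_mul :
  Sigma2 (a - a * b * a) = [set 0] -> greatest_idem (Sigma2 a) (a * b).
Proof.
move=> S0; split; first exact: Sigma2_mul.
move=> e /Sigma2_elim[ee he [u [hu eu ue au ua]]].
have pe := bicommutant_comm hab he.
have pa := bicommutant_comm hab (bicommutant_self a).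
suff : Sigma2 (a - a * b * a) (e - e * (a * b)).
  by rewrite S0 => /eqP; rewrite subr_eq0 => /eqP ep; split; rewrite ?pe -ep.
have fp : (e - e * (a * b)) * (a * b) = 0.
  by rewrite mulrBl -[_ * _ * (a * b)]mulrA abab subrr.
have fe : (e - e * (a * b)) * e = e - e * (a * b).
  by rewrite mulrBl -mulrA pe [e * (e * _)]mulrA ee.
apply/Sigma2_sub; split=> //.
(* The inverse [u] for [e] is cut down by [1 - p] to one for [e(1 - p)]. *)
apply: (@Sigma2_intro _ _ (u - u * (a * b))).
- by rewrite mulrBr [_ * (e * _)]mulrA fe fp subr0.
- by apply: bicommutantB => //; apply: bicommutantM.
- by rewrite mulrBr mulrA au.
- by rewrite mulrBl -mulrA pa [u * (a * _)]mulrA ua.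
Qed.

Lemma greatest_mul_Sigma2 :
  greatest_idem (Sigma2 a) (a * b) -> Sigma2 (a - a * b * a) = [set 0].
Proof.
move=> [_ abM]; apply/seteqP; split=> e.
  by move=> /Sigma2_sub[/abM[ep _]]; rewrite ep.
move=> ->; apply: (@Sigma2_intro _ _ 0); rewrite ?mulr0 ?mul0r //.
exact: bicommutant0.
Qed.

End Reduction.

(** The group inverse of [x] plays the role of [b]: as [yz = 0], [a] and [x] have the same products
    with [z], so [aza = x]. *)
Lemma group_inverse_decomposition a x y z :
  a = x + y -> bicommutant [set a] x -> group_inverse x z -> x * y = 0 ->
  [/\ bicommutant [set a] z, z * a * z = z & a - a * z * a = y].
Proof.
move=> aE hx gz xy; have [xzx zxz xz] := gz.
have hz := bicommutant_trans hx (group_inverse_bicommutant gz).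
(* Since [x] commutes with [a = x + y], it commutes with [y]. *)
have yx : y * x = 0.
  have := bicommutant_comm hx (bicommutant_self a).
  by rewrite aE mulrDr mulrDl xy addr0 => /eqP; rewrite addrC -subr_eq subrr
    eq_sym => /eqP.
have yz : y * z = 0 by rewrite -zxz -xz -!mulrA mulrA yx mul0r.
have az : a * z = x * z by rewrite aE mulrDl yz addr0.
have za : z * a = z * x.
  by rewrite (bicommutant_comm hz (bicommutant_self a)) az.
split=> //; first by rewrite za.
by rewrite az -mulrA za mulrA xzx aE addrC addKr.
Qed.

End Sigma2.

Theorem theorem4p5 (R : pzRingType) (a : R) :
  [<-> naturally_invertible a;
       exists b : R, [/\ bicommutant [set a] b, b * a * b = b
                   & Sigma2 (a - a * b * a) = [set 0]];
       exists x y : R, [/\ a = x + y, bicommutant [set a] x,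
                       (exists z : R, group_inverse x z), x * y = 0
                     & Sigma2 y = [set 0]]]
  /\
  (forall M b x y : R,
     greatest_idem (Sigma2 a) M ->
     [/\ bicommutant [set a] b, b * a * b = b
       & Sigma2 (a - a * b * a) = [set 0]] ->
     [/\ a = x + y, bicommutant [set a] x,
         (exists z : R, group_inverse x z), x * y = 0
       & Sigma2 y = [set 0]] ->
     unique (inverse_along a M) b /\ unique (group_inverse x) b).
Proof.
have ha := bicommutant_self a.
split.
  split.
  (* Take for [b] the inverse of [aM] in the corner of [M], so that [ab = M]. *)
  - move=> [M MM]; have [/Sigma2_elim[_ _ [b [hb _ bM ab _]]] _] := MM.
    have bab : b * a * b = b by rewrite -mulrA ab.
    exists b; split=> //; apply: greatest_mul_Sigma2 => //.
    by rewrite ab.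
  split; last first.
  - move=> [x [y [aE hx [z gz] xy y0]]].
    have [hz zaz ay] := group_inverse_decomposition aE hx gz xy.
    by exists (a * z); apply: greatest_Sigma2_mul; rewrite ?ay.
  - move=> [b [hb bab S0]]; have ab := bicommutant_comm ha hb.
    have bK t : b * (a * (b * t)) = b * t by rewrite !mulrA bab.
    have bab' : b * (a * b) = b by rewrite mulrA.
    (* The group inverse of [aba] is [b]. *)
    exists (a * b * a), (a - a * b * a); split=> //.
    + by rewrite addrC subrK.
    + by apply: bicommutantM => //; apply: bicommutantM.
    + exists b; split.
      * by rewrite -!mulrA !bK.
      * by rewrite -!mulrA bK.
      * by rewrite -!mulrA bK bab'.
    + have aba : a * (b * a) = b * (a * a) by rewrite mulrA ab mulrA.
      by rewrite mulrBr -!mulrA [in X in _ - X]aba bK subrr.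
have inv b M : greatest_idem (Sigma2 a) M -> bicommutant [set a] b ->
    b * a * b = b -> Sigma2 (a - a * b * a) = [set 0] -> inverse_along a M b.
  move=> [SM leM] hb bab /(greatest_Sigma2_mul hb bab)[Sp lep].
  (* Both [M] and [p = ab] are greatest, so [M = pM = p]. *)
  have [_ <-] := lep _ SM; have [-> _] := leM _ Sp.
  apply: inverse_along_mul => //; exact: bicommutant_comm ha hb.
move=> M b x y MM [hb bab S0] [aE hx [z gz] xy y0].
have invb := inv _ _ MM hb bab S0.
(* Every group inverse of [x] satisfies the conditions on [b], so it too is the inverse of [a] along
   [M]. *)
have ginv z' : group_inverse x z' -> b = z'.
  move=> gz'; have [hz zaz ay] := group_inverse_decomposition aE hx gz' xy.
  by apply: inverse_along_uniq invb _; apply: inv; rewrite ?ay.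
split; split=> //; last by rewrite (ginv z gz).
by move=> b'; apply: inverse_along_uniq.
Qed.
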